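(* Let $0<p<1$ be fixed, $b=1/(1-p)$, and $c=c(n)=\lfloor \log_b n-\log_b[(\log_b n)(\log n)]\rfloor+2$. Then asymptotically almost surely (i.e. with probability tending to $1$ as $n\to\infty$) $G(n,p,c)$ contains a tropical dominating set of size $c$.
   Context: $G(n,p)$ is the random graph on $n$ vertices in which each of the $\binom n2$ edges is present independently with probability $p$. For a positive integer $c$, $G(n,p,c)$ is obtained from $G(n,p)$ by colouring each vertex with one of the colours $1,\dots,c$ uniformly at random, independently of each other and of the edges. A dominating set is tropical if every one of the $c$ colours appears on at least one of its vertices. $\log$ denotes the natural logarithm. *)

(* Defs.v *)
From mathcomp Require Import all_boot.
From Stdlib Require Import Reals.

Set Implicit Arguments.
Unset Strict Implicit.
Unset Printing Implicit Defensive.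

(* Potential edges of K_n on vertex set 'I_n: unordered pairs {u,v}, encoded as (u,v) with u < v. *)
Definition edge (n : nat) := {e : 'I_n * 'I_n | (e.1 < e.2)%N}.

Definition adj (n : nat) (G : {set edge n}) (u v : 'I_n) : bool :=
  [exists e in G, (val e == (u, v)) || (val e == (v, u))].

Definition dominating (n : nat) (G : {set edge n}) (D : {set 'I_n}) : bool :=
  [forall v : 'I_n, (v \in D) || [exists u in D, adj G u v]].

Definition tropical (n c : nat) (col : {ffun 'I_n -> 'I_c}) (D : {set 'I_n}) : bool :=
  [forall k : 'I_c, [exists v in D, col v == k]].

Definition has_trop_dom (n c : nat) (G : {set edge n}) (col : {ffun 'I_n -> 'I_c}) : bool :=
  [exists D : {set 'I_n}, [&& #|D| == c, dominating G D & tropical col D]].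

(* Probability of an outcome (G, col) of G(n,p,c): edges independent with prob. p,
   colours independent uniform on c colours. *)
Definition weight (n c : nat) (p : R) (G : {set edge n}) : R :=
  (p ^ #|G| * (1 - p) ^ #|~: G| * (/ INR c) ^ n)%R.

Definition trop_dom_prob (p : R) (n c : nat) : R :=
  \big[Rplus/0%R]_(G : {set edge n})
    \big[Rplus/0%R]_(col : {ffun 'I_n -> 'I_c} | has_trop_dom G col) weight c p G.

Definition logb (p x : R) : R := (ln x / ln (1 / (1 - p)))%R.

Definition cfun (p : R) (n : nat) : nat :=
  Z.to_nat (Int_part (logb p (INR n) - logb p (logb p (INR n) * ln (INR n)))%R + 2)%Z.

(* Main.v *)
(** Second moment method over maps [f : 'I_c -> 'I_n]: call [f] a hit if
    [f i] has colour [i] for all [i] and the image of [f] is dominating.  Put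
    [q = 1 - p] and [a = q ^ c].  Two maps that agree at exactly [k] colours
    and respect a common colouring have images with union of size [2c - k], so
    both are hits with probability at most
      [c ^ -(2c - k) * (1 - 2 a + q ^ (2c - k)) ^ (n - 2c + k)].
    Convexity of [q ^ x] bounds the second factor by [(1 - a) ^ 2n * y ^ k], up
    to a factor [(1 - a) ^ -4c], where [y = exp (n a / (c (1 - a) ^ 2))].  The
    sum of [(c y) ^ k] over all pairs of maps is [(n (n - 1 + c y)) ^ c], and the
    probability that there is no hit is at most [c (4 a + 2 c / n + c y / n)].
    For the given [c], [n a <= q (log_b n) (log n)] and [c ~ log_b n], hence [y] is
    at most [n ^ (1 - p / 2)] and this error vanishes. *)
Require Import Defs.
From mathcomp Require Import all_boot all_order all_algebra.
From mathcomp Require ring lra.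
Set Implicit Arguments.
Unset Strict Implicit.
Unset Printing Implicit Defensive.

(** * Stars of potential edges and domination *)

Section Stars.
Variable n : nat.
Implicit Types (G : {set edge n}) (S T : {set 'I_n}) (u v : 'I_n) (e : edge n).

(** A graph gives [v] no neighbour in [T] exactly when it avoids this set, so domination turns into
    disjointness from fixed edge sets. *)
Definition star v T : {set edge n} :=
  [set e | (((val e).1 == v) && ((val e).2 \in T))
           || (((val e).2 == v) && ((val e).1 \in T))].

Lemma edgeP u v : u != v ->
  exists e, ((val e == (u, v)) || (val e == (v, u))).
Proof.
rewrite neq_ltn => /orP[uv|vu].
  by exists (Sub (u, v) uv); rewrite SubK eqxx.
by exists (Sub (v, u) vu); rewrite SubK eqxx orbT.
Qed.

Lemma exists_adj G T v :
  [exists u in T, adj G u v] = ~~ [disjoint star v T & G].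
Proof.
apply/idP/idP.
  case/existsP=> u /andP[uT /existsP[e /andP[eG He]]].
  apply/pred0Pn; exists e; rewrite /= eG andbT inE.
  by case/orP: He => /eqP-> /=; rewrite eqxx uT ?orbT.
case/pred0Pn=> e /= /andP[]; rewrite inE => /orP[]/andP[/eqP He uT] eG.
  apply/existsP; exists (val e).2; rewrite uT; apply/existsP; exists e.
  by rewrite eG -He -surjective_pairing eqxx orbT.
apply/existsP; exists (val e).1; rewrite uT; apply/existsP; exists e.
by rewrite eG -He -surjective_pairing eqxx.
Qed.

(** An edge of the star is determined by its endpoint other than [v], and that endpoint ranges over
    [T]. *)
Lemma card_star v T : v \notin T -> #|star v T| = #|T|.
Proof.
move=> vT; pose h e := if (val e).1 == v then (val e).2 else (val e).1.
have hinj : {in star v T &, injective h}.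
  move=> e e'; rewrite !inE /h => H H' E; apply/val_inj.
  case: (val e) (val e') (valP e) (valP e') H H' E => [a b] [a' b'] /= ab ab'.
  case: (eqVneq a v) => [av|av]; case: (eqVneq a' v) => [a'v|a'v] //=.
  - by move=> _ _ ->; rewrite av a'v.
  (* The edges would be [(v, b)] and [(b, v)], and only one of these is increasing. *)
  - move=> _ /andP[/eqP b'v _] ba'.
    by move: ab ab'; rewrite av ba' b'v => /ltn_trans h1 /h1; rewrite ltnn.
  - move=> /andP[/eqP bv _] _ ab1.
    by move: ab ab'; rewrite ab1 bv a'v => /ltn_trans h1 /h1; rewrite ltnn.
  - by move=> /andP[/eqP-> _] /andP[/eqP-> _] ->.
rewrite -(card_in_imset hinj); congr #|pred_of_set _|.
apply/setP=> u; apply/imsetP/idP.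
  case=> e; rewrite inE /h => /orP[]/andP[/eqP E uT] ->; first by rewrite E eqxx.
  by case: eqP => // E'; rewrite E' (negPf vT) in uT.
move=> uT; have uv : u != v by apply: contraNneq vT => <-.
case: (edgeP uv) => e /orP[]/eqP He; exists e; rewrite ?inE /h He /= ?eqxx ?uT ?orbT //.
by rewrite (negPf uv).
Qed.
End Stars.

(** * Graph weights and independence of disjoint stars *)

Section Moments.
Import Order.TTheory GRing.Theory Num.Theory.
Import ring lra.
Local Open Scope ring_scope.
Variables (F : realFieldType) (n : nat) (p q : F).
Hypotheses (p0 : 0 <= p) (q0 : 0 <= q) (pq : p + q = 1).
Implicit Types (G : {set edge n}) (S T D : {set 'I_n}).

Definition edge_weight G : F := p ^+ #|G| * q ^+ #|~: G|.

Lemma edge_weightE G :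
  edge_weight G = \prod_e (if e \in G then p else q).
Proof.
rewrite /edge_weight (bigID (mem G)) /=; congr (_ * _).
  by rewrite (eq_bigr (fun=> p)) ?prodr_const // => e ->.
rewrite (eq_bigr (fun=> q)) => [|e /negPf-> //].
by rewrite prodr_const; congr (_ ^+ _); apply: eq_card => e; rewrite !inE.
Qed.

Lemma edge_weight_ge0 G : 0 <= edge_weight G.
Proof. by rewrite mulr_ge0 // exprn_ge0. Qed.

(** Expand a product over edges: the left summand stands for a present edge, and its value 0 on [A]
    removes every graph that meets [A]. *)
Lemma edge_weight_disjoint (A : {set edge n}) :
  \sum_G edge_weight G * [disjoint A & G]%:R = q ^+ #|A|.
Proof.
have -> : q ^+ #|A| = \prod_e ((if e \in A then 0 else p) + q).
  rewrite (bigID (mem A)) /= (eq_bigr (fun=> q)) => [|e ->]; last by rewrite add0r.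
  rewrite prodr_const big1 ?mulr1 // => e /negPf->; exact: pq.
rewrite bigA_distr; apply: eq_bigr => G _; rewrite edge_weightE.
case: (boolP [disjoint A & G]) => [dAG|].
  rewrite mulr1; apply: eq_bigr => e _; case: ifP => // eG.
  by rewrite (disjointFl dAG eG).
case/pred0Pn => e /= /andP[eA eG].
by rewrite mulr0 (bigD1 e) //= eG eA mul0r.
Qed.

Lemma edge_weight_sum : \sum_G edge_weight G = 1.
Proof.
rewrite -[RHS](expr0 q) -(cards0 (edge n)) -edge_weight_disjoint.
by apply: eq_bigr => G _; rewrite disjoints_subset sub0set mulr1.
Qed.

Lemma disjoint_bigcup (I : finType) (A : I -> {set edge n}) (P : pred I) G :
  [disjoint \bigcup_(i | P i) A i & G]%:R
   = \prod_(i | P i) [disjoint A i & G]%:R :> F.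
Proof.
elim/big_rec2: _ => [|i x B _ <-]; first by rewrite disjoints_subset sub0set.
by rewrite !disjoints_subset subUset -natrM mulnb.
Qed.

Lemma natr_forall (I : finType) (W : {set I}) (P : pred I) :
  [forall v in W, P v]%:R = \prod_(v in W) (P v)%:R :> F.
Proof.
rewrite -big_andE; apply: (big_morph (fun b : bool => b%:R)) => // x y.
by rewrite -natrM mulnb.
Qed.

(* The stars at distinct vertices of [W] are disjoint as their leaves avoid [W]. *)
Lemma edge_weight_stars (W : {set 'I_n}) (A : 'I_n -> {set 'I_n}) :
  (forall v, [disjoint A v & W]) ->
  \sum_G edge_weight G * \prod_(v in W) [disjoint star v (A v) & G]%:R
   = \prod_(v in W) q ^+ #|A v|.
Proof.
move=> dAW.
transitivity (\sum_G edge_weight G *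
    [disjoint \bigcup_(v in W) star v (A v) & G]%:R).
  by apply: eq_bigr => G _; rewrite disjoint_bigcup.
rewrite edge_weight_disjoint prodrXr; congr (_ ^+ _).
have tI v w : v \in W -> w \in W -> v != w ->
    [disjoint star v (A v) & star w (A w)].
  move=> vW wW /eqP vw; apply/pred0P => e /=; apply/negP; rewrite !inE.
  have AW x u : x \in A u -> x \in W -> False.
    by move=> xA; rewrite (disjointFr (dAW u) xA).
  case/andP=> /orP[]/andP[/eqP E1 E2] /orP[]/andP[/eqP E3 E4].
  - by apply: vw; rewrite -E1 -E3.
  - by apply: AW E4 _; rewrite E1.
  - by apply: AW E4 _; rewrite E1.
  - by apply: vw; rewrite -E1 -E3.
rewrite big_mkcond /= -sum1_card partition_disjoint_bigcup => [|v w vw].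
  rewrite [RHS]big_mkcond /=; apply: eq_bigr => v _; rewrite sum1_card.
  case: ifP => [vW|_]; last by rewrite cards0.
  by rewrite card_star // (disjointFl (dAW v)).
case: ifP => [vW|_]; last by rewrite disjoints_subset sub0set.
case: ifP => [wW|_]; last by rewrite disjoint_sym disjoints_subset sub0set.
exact: tI.
Qed.

(** Distribute the product over the sums; for each choice of one index per vertex the chosen stars
    are disjoint, so the expectation factors again. *)
Lemma edge_weight_prod (I : finType) (i0 : I) (a : I -> F) (T : I -> {set 'I_n})
    (W : {set 'I_n}) :
  (forall i, [disjoint T i & W]) ->
  \sum_G edge_weight G *
    \prod_(v in W) \sum_i a i * [disjoint star v (T i) & G]%:R
   = (\sum_i a i * q ^+ #|T i|) ^+ #|W|.
Proof.
(* [i0] is the value of a choice function outside [W]. *)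
move=> dT; rewrite -prodr_const (big_distr_big i0) /=.
under eq_bigr do rewrite (big_distr_big i0) mulr_sumr /=.
rewrite exchange_big /=; apply: eq_bigr => f _.
rewrite big_split /= -(@edge_weight_stars W (fun v => T (f v))) //.
rewrite mulr_sumr; apply: eq_bigr => G _.
by rewrite big_split /= mulrCA.
Qed.

(** Domination is asked only on [S]: with [S] outside both sets of a pair, the events at different
    vertices are independent. *)
Definition dom_out G D S : bool :=
  [forall v in S, ~~ [disjoint star v D & G]].

Lemma prob_dom_out2 D D' :
  \sum_G edge_weight G * (dom_out G D (~: (D :|: D')) && dom_out G D' (~: (D :|: D')))%:R
  = (1 - q ^+ #|D| - q ^+ #|D'| + q ^+ #|D :|: D'|) ^+ #|~: (D :|: D')|.
Proof.
set W := ~: _.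
(* Pairs of booleans index the four terms of inclusion-exclusion at a vertex: [T] is the set without
   neighbours of it, [a] the sign. *)
pose T (b : bool * bool) := (if b.1 then D else set0) :|: (if b.2 then D' else set0).
pose a (b : bool * bool) : F := (-1) ^+ b.1 * (-1) ^+ b.2.
have dT i : [disjoint T i & W].
  rewrite disjoints_subset setCK /T.
  by case: i => [[] []] /=; rewrite ?set0U ?setU0 ?subsetUl ?subsetUr ?sub0set.
have H (g : {set 'I_n} -> F) : g set0 - g D - g D' + g (D :|: D') = \sum_i a i * g (T i).
  rewrite -(pair_big xpredT xpredT (fun x y => a (x, y) * g (T (x, y)))) /=.
  rewrite !big_bool /= /a /T /= !set0U setU0 !expr1 !expr0; ring.
have -> : 1 - q ^+ #|D| - q ^+ #|D'| + q ^+ #|D :|: D'|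
    = \sum_i a i * q ^+ #|T i|.
  by rewrite -(H (fun X => q ^+ #|X|)) cards0.
rewrite -(edge_weight_prod (false, false) a dT).
apply: eq_bigr => G _; congr (_ * _).
have E v : \sum_i a i * [disjoint star v (T i) & G]%:R
    = (~~ [disjoint star v D & G] && ~~ [disjoint star v D' & G])%:R.
  rewrite -(H (fun X => [disjoint star v X & G]%:R)).
  have -> : star v (D :|: D') = star v D :|: star v D'.
    by apply/setP=> e; rewrite !inE; do !case: (_ \in _); do !case: (_ == _).
  have -> : star v set0 = set0 by apply/setP=> e; rewrite !inE !andbF.
  rewrite !disjoints_subset sub0set subUset.
  by case: (_ \subset _); case: (_ \subset _) => /=; ring.
under [RHS]eq_bigr do rewrite E.
rewrite -natr_forall; congr (_ *+ nat_of_bool _).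
apply/andP/forall_inP => [[/forall_inP h1 /forall_inP h2] v vW|h].
  by rewrite h1 ?h2.
by split; apply/forall_inP => v /h /andP[].
Qed.

(** * Random colourings and maps that pick one vertex per colour *)

Variable c : nat.
Hypothesis c0 : (0 < c)%N.
Implicit Types (f g : {ffun 'I_c -> 'I_n}) (col : {ffun 'I_n -> 'I_c}).

Definition proper f col : bool := [forall i, col (f i) == i].

Lemma proper_cancel f col : proper f col -> cancel f col.
Proof. by move=> /forallP h i; apply/eqP. Qed.

(** Vertices are coloured independently: one in [U] has a prescribed colour and contributes [1 / c],
    any other contributes 1. *)
Lemma card_agree (U : {set 'I_n}) col0 :
  \sum_(col : {ffun 'I_n -> 'I_c}) (c%:R^-1) ^+ n * [forall v in U, col v == col0 v]%:R
  = (c%:R^-1) ^+ #|U| :> F.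
Proof.
have c1 : c%:R != 0 :> F by rewrite pnatr_eq0 -lt0n.
transitivity (\prod_v \sum_(k : 'I_c)
   (c%:R^-1 * ((v \in U) ==> (k == col0 v))%:R) : F).
  rewrite bigA_distr_bigA; apply: eq_bigr => col _.
  rewrite big_split /= prodr_const card_ord; congr (_ * _).
  rewrite natr_forall [LHS]big_mkcond; apply: eq_bigr => v _.
  by case: (v \in U).
rewrite -prodr_const [RHS]big_mkcond; apply: eq_bigr => v _.
case: (v \in U) => /=.
  rewrite (bigD1 (col0 v)) //= eqxx mulr1 big1 ?addr0 // => k /negPf->.
  by rewrite mulr0.
by rewrite sumr_const card_ord mulr1 -[LHS]mulr_natl divff.
Qed.

(** On either image [col0] takes the only colour that properness allows there. *)
Lemma proper2_agree f g col0 col : proper f col0 -> proper g col0 ->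
  (proper f col && proper g col) =
  [forall v in f @: 'I_c :|: g @: 'I_c, col v == col0 v].
Proof.
move=> /proper_cancel f0 /proper_cancel g0.
apply/andP/forall_inP => [[/proper_cancel f1 /proper_cancel g1] v|h].
  by rewrite inE => /orP[] /imsetP[i _ ->]; rewrite ?f0 ?f1 ?g0 ?g1.
split; apply/forallP=> i.
  by rewrite (eqP (h (f i) _)) ?f0 // inE imset_f.
by rewrite (eqP (h (g i) _)) ?g0 // inE imset_f ?orbT.
Qed.

Lemma proper2_prob f g col0 : proper f col0 -> proper g col0 ->
  \sum_(col : {ffun 'I_n -> 'I_c}) (c%:R^-1) ^+ n * (proper f col && proper g col)%:R
  = (c%:R^-1) ^+ #|f @: 'I_c :|: g @: 'I_c| :> F.
Proof.
move=> f0 g0; rewrite -(card_agree _ col0).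
by apply: eq_bigr => col _; rewrite (proper2_agree _ f0 g0).
Qed.

(** A vertex in both images has one colour under [col0], so both maps take it at that colour: the
    images meet exactly in the agreements. *)
Lemma card_proper2 f g col0 : proper f col0 -> proper g col0 ->
  (#|f @: 'I_c :|: g @: 'I_c| + #|[set i | f i == g i]| = c + c)%N.
Proof.
move=> /proper_cancel f0 /proper_cancel g0.
rewrite -(card_imset _ (can_inj f0)).
have -> : f @: [set i | f i == g i] = f @: 'I_c :&: g @: 'I_c.
  apply/setP=> v; rewrite inE; apply/imsetP/andP.
    by case=> i; rewrite inE => /eqP E ->; rewrite imset_f // E imset_f.
  case=> /imsetP[i _ ->] /imsetP[j _ E]; exists i => //.
  by rewrite inE {2}(_ : i = j) ?E //; move: (f0 i); rewrite E g0.
by rewrite cardsUI !card_imset ?card_ord //; exact: can_inj.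
Qed.

Lemma proper_exists f : injective f -> exists col, proper f col.
Proof.
move=> finj; exists [ffun v => odflt (Ordinal c0) [pick i | f i == v]].
apply/forallP=> i; rewrite ffunE; case: pickP => [j /eqP/finj->//|/(_ i)].
by rewrite eqxx.
Qed.

(** * Expectation over graphs and colourings *)

Definition mean (h : {set edge n} -> {ffun 'I_n -> 'I_c} -> F) : F :=
  \sum_G \sum_(col : {ffun 'I_n -> 'I_c}) edge_weight G * (c%:R^-1) ^+ n * h G col.

Lemma weight_ge0 G : 0 <= edge_weight G * (c%:R^-1) ^+ n.
Proof. by rewrite mulr_ge0 ?edge_weight_ge0 ?exprn_ge0 ?invr_ge0. Qed.

Lemma mean_le h h' : (forall G col, h G col <= h' G col) -> mean h <= mean h'.
Proof.
move=> hh; apply: ler_sum => G _; apply: ler_sum => col _.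
by rewrite ler_wpM2l ?weight_ge0.
Qed.

Lemma mean_prod (h : {set edge n} -> F) (h' : {ffun 'I_n -> 'I_c} -> F) :
  mean (fun G col => h G * h' col)
  = (\sum_G edge_weight G * h G) *
    (\sum_(col : {ffun 'I_n -> 'I_c}) (c%:R^-1) ^+ n * h' col).
Proof.
rewrite big_distrlr /=; apply: eq_bigr => G _; apply: eq_bigr => col _; ring.
Qed.

Lemma mean_sum (I : finType) (h : I -> {set edge n} -> {ffun 'I_n -> 'I_c} -> F) :
  mean (fun G col => \sum_i h i G col) = \sum_i mean (h i).
Proof.
rewrite /mean [RHS]exchange_big; apply: eq_bigr => G _.
rewrite [RHS]exchange_big; apply: eq_bigr => col _; exact: mulr_sumr.
Qed.

Lemma meanB x y h h' :
  mean (fun G col => x * h G col - y * h' G col) = x * mean h - y * mean h'.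
Proof.
rewrite /mean !mulr_sumr -sumrB; apply: eq_bigr => G _.
rewrite !mulr_sumr -sumrB; apply: eq_bigr => col _; ring.
Qed.

Lemma mean1 : mean (fun _ _ => 1) = 1.
Proof.
transitivity (mean (fun _ _ => 1 * 1)).
  by apply: eq_bigr => G _; apply: eq_bigr => col _; rewrite !mulr1.
rewrite mean_prod; under eq_bigr do rewrite mulr1.
rewrite edge_weight_sum mul1r sumr_const card_ffun !card_ord mulr1 -[LHS]mulr_natl.
by rewrite natrX exprVn divff // expf_neq0 // pnatr_eq0 -lt0n.
Qed.

(** * Hits and the probability of a single hit *)

Definition hit f G col : bool := proper f col && dominating G (f @: 'I_c).

Definition hits G col : F := \sum_f (hit f G col)%:R.

Lemma dominatingE G D : dominating G D = dom_out G D (~: D).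
Proof.
apply: eq_forallb => v; rewrite exists_adj inE implybE negbK //.
Qed.

Lemma dom_outS G D S S' : S' \subset S -> dom_out G D S -> dom_out G D S'.
Proof.
by move=> sS /forall_inP h; apply/forall_inP => v /(subsetP sS) /h.
Qed.

Lemma hit_trop_dom f G col : hit f G col -> has_trop_dom G col.
Proof.
case/andP=> /proper_cancel fK domf; apply/existsP; exists (f @: 'I_c).
rewrite card_imset ?card_ord ?eqxx ?domf /=; last exact: can_inj fK.
apply/forallP => k; apply/existsP; exists (f k).
by rewrite imset_f // fK eqxx.
Qed.

Definition agree f g := #|[set i | f i == g i]|.

Lemma agree_le f g : (agree f g <= c)%N.
Proof. by rewrite -[X in (_ <= X)%N](card_ord c) max_card. Qed.

Local Notation a := (q ^+ c).

Lemma q_le1 : q <= 1. Proof. by rewrite -pq lerDr. Qed.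

Lemma a_le1 : a <= 1. Proof. by rewrite exprn_ile1 ?q_le1. Qed.

(** The pair computation with both maps equal to [f] gives exponent [n - c], relaxed here to [n]. *)
Lemma hit_prob f : injective f ->
  c%:R^-1 ^+ c * (1 - a) ^+ n <= mean (fun G col => (hit f G col)%:R).
Proof.
move=> finj; have [col0 f0] := proper_exists finj.
have cD : #|f @: 'I_c| = c by rewrite card_imset ?card_ord.
have -> : mean (fun G col => (hit f G col)%:R)
    = mean (fun G col => (dom_out G (f @: 'I_c) (~: (f @: 'I_c :|: f @: 'I_c))
                   && dom_out G (f @: 'I_c) (~: (f @: 'I_c :|: f @: 'I_c)))%:R *
              (proper f col && proper f col)%:R).
  apply: eq_bigr => G _; apply: eq_bigr => col _; congr (_ * _).
  by rewrite setUid !andbb -dominatingE -natrM mulnb andbC.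
rewrite mean_prod prob_dom_out2 (proper2_prob f0 f0) setUid cD mulrC.
rewrite ler_wpM2r ?exprn_ge0 ?invr_ge0 // subrK ler_wiXn2l ?subr_ge0 ?a_le1 //.
  by rewrite gerBl exprn_ge0.
by rewrite -[X in (_ <= X)%N](card_ord n) max_card.
Qed.

(** * Second moment of the number of hits *)

Section SecondMoment.
Variable y : F.
Hypotheses (y0 : 0 <= y)
  (hy : forall k, (k <= c)%N ->
     (1 - a - a + q ^+ (c + c - k)) ^+ n <= (1 - a) ^+ (2 * n) * y ^+ k).

(** If no colouring is proper for both maps, the mean is 0. Otherwise domination is relaxed to the
    vertices outside both images, and [(1 - a) ^+ (4 * c)] pays for raising the exponent from
    [n - #|U|] to [n], where [hy] applies. *)
Lemma hit2_prob f g :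
  mean (fun G col => (hit f G col && hit g G col)%:R) * (1 - a) ^+ (4 * c)
  <= c%:R^-1 ^+ (2 * c) * (1 - a) ^+ (2 * n) * (c%:R * y) ^+ agree f g.
Proof.
have a1 : 0 <= 1 - a by rewrite subr_ge0 a_le1.
have a1' : 1 - a <= 1 by rewrite gerBl exprn_ge0.
have [|no] := boolP [exists col, proper f col && proper g col]; last first.
  rewrite /mean big1 ?mul0r ?mulr_ge0 ?exprn_ge0 ?invr_ge0 ?mulr_ge0 // => G _.
  rewrite big1 // => col _.
  suff -> : hit f G col && hit g G col = false by rewrite mulr0.
  apply: contraNF no => /andP[/andP[h _] /andP[h' _]].
  by apply/existsP; exists col; rewrite h.
case/existsP => col0 /andP[f0 g0].
set D := f @: 'I_c; set D' := g @: 'I_c; set U := D :|: D'.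
have cD : #|D| = c.
  by rewrite card_imset ?card_ord //; apply: can_inj (proper_cancel f0).
have cD' : #|D'| = c.
  by rewrite card_imset ?card_ord //; apply: can_inj (proper_cancel g0).
have cU : (#|U| + agree f g = c + c)%N := card_proper2 f0 g0.
have cU' : #|U| = (c + c - agree f g)%N by rewrite -cU addnK.
have le1 : mean (fun G col => (hit f G col && hit g G col)%:R)
   <= mean (fun G col => (dom_out G D (~: U) && dom_out G D' (~: U))%:R *
                         (proper f col && proper g col)%:R).
  apply: mean_le => G col; rewrite -natrM mulnb ler_nat.
  case: (boolP (hit f G col && hit g G col)) => // /andP[/andP[-> h] /andP[-> h']].
  rewrite !dominatingE in h h'.
  by rewrite (dom_outS _ h) ?(dom_outS _ h') // setCS ?subsetUl ?subsetUr.
apply: le_trans (ler_wpM2r _ le1) _; first by rewrite exprn_ge0.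
rewrite mean_prod prob_dom_out2 (proper2_prob f0 g0) -/D -/D' -/U cD cD'.
set B := (1 - a - a + _).
have B2 : (1 - a) ^+ 2 <= B.
  have : q ^+ (c + c) <= q ^+ #|U|.
    by rewrite ler_wiXn2l ?q_le1 // -cU leq_addr.
  by rewrite /B exprD; lra.
(* Each missing factor [B] is at least [(1 - a) ^+ 2], and at most [2 * c] are missing. *)
have le2 : B ^+ #|~: U| * (1 - a) ^+ (4 * c) <= (1 - a) ^+ (2 * n) * y ^+ agree f g.
  apply: le_trans (hy (agree_le f g)); rewrite -cU' -/B.
  rewrite [X in _ <= X](_ : _ = B ^+ (#|~: U| + #|U|)); last first.
    by rewrite addnC cardsC card_ord.
  rewrite exprD ler_wpM2l ?exprn_ge0 ?(le_trans (sqr_ge0 _) B2) //.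
  apply: le_trans (_ : ((1 - a) ^+ 2) ^+ #|U| <= _).
    rewrite -exprM ler_wiXn2l // (_ : 4 = 2 * 2)%N // -mulnA leq_mul2l /=.
    by rewrite mul2n -addnn -cU leq_addr.
  by rewrite lerXn2r ?nnegrE ?sqr_ge0 ?(le_trans (sqr_ge0 _) B2).
rewrite mulrAC; apply: le_trans (ler_wpM2r _ le2) _.
  by rewrite exprn_ge0 ?invr_ge0.
have -> : c%:R^-1 ^+ (2 * c) * (1 - a) ^+ (2 * n) * (c%:R * y) ^+ agree f g
   = (1 - a) ^+ (2 * n) * y ^+ agree f g * (c%:R^-1 ^+ (2 * c) * c%:R ^+ agree f g).
  by rewrite exprMn; ring.
have c1 : c%:R != 0 :> F by rewrite pnatr_eq0 -lt0n.
by rewrite (mul2n c) -addnn -cU exprD -(mulrA (_ ^+ #|U|)) -exprMn mulVf // expr1n mulr1.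
Qed.

(** For fixed [f], choose [g] colour by colour: the agreeing value has weight [z], the other [n - 1]
    values have weight 1. *)
Lemma sum_agree (z : F) :
  \sum_f \sum_g z ^+ agree f g = (n%:R * (n%:R - 1 + z)) ^+ c.
Proof.
have E f : \sum_g z ^+ agree f g = (n%:R - 1 + z) ^+ c.
  transitivity (\prod_(i < c) \sum_(v : 'I_n) (if f i == v then z else 1)).
    rewrite bigA_distr_bigA; apply: eq_bigr => g _.
    by rewrite -big_mkcond prodr_const; congr (_ ^+ _); apply: eq_card => i; rewrite !inE.
  rewrite -[X in _ = _ ^+ X](card_ord c) -prodr_const; apply: eq_bigr => i _.
  rewrite (bigD1 (f i)) //= eqxx (eq_bigr (fun=> 1)) => [|v /negPf].
    rewrite sumr_const addrC; congr (_ + _).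
    rewrite (eq_card (B := predC1 (f i))) // cardC1 card_ord -subn1 natrB //.
    exact: leq_ltn_trans (ltn_ord (f i)).
  by rewrite eq_sym => ->.
under eq_bigr do rewrite E.
by rewrite sumr_const card_ffun !card_ord exprMn -[LHS]mulr_natl natrX.
Qed.

Lemma mean_hits : (n ^_ c)%:R * (c%:R^-1 ^+ c * (1 - a) ^+ n) <= mean hits.
Proof.
rewrite /hits mean_sum -[X in (_ ^_ X)](card_ord c) -[X in (X ^_ _)](card_ord n).
rewrite -card_inj_ffuns mulr_natl -sumr_const.
rewrite [leLHS]big_mkcond; apply: ler_sum => f _; case: ifP => [|_].
  by rewrite inE => /injectiveP /hit_prob.
by apply: sumr_ge0 => G _; apply: sumr_ge0 => col _; rewrite mulr_ge0 ?weight_ge0.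
Qed.

Lemma mean_hits2 :
  mean (fun G col => hits G col ^+ 2) * (1 - a) ^+ (4 * c)
  <= c%:R^-1 ^+ (2 * c) * (1 - a) ^+ (2 * n) * (n%:R * (n%:R - 1 + c%:R * y)) ^+ c.
Proof.
rewrite -sum_agree.
have -> : mean (fun G col => hits G col ^+ 2) =
    \sum_f \sum_g mean (fun G col => (hit f G col && hit g G col)%:R).
  transitivity (mean (fun G col =>
      \sum_f \sum_g (hit f G col && hit g G col)%:R)).
    apply: eq_bigr => G _; apply: eq_bigr => col _; congr (_ * _).
    rewrite expr2 /hits big_distrlr /=; apply: eq_bigr => f _; apply: eq_bigr => g _.
    by rewrite -natrM mulnb.
  by rewrite mean_sum; apply: eq_bigr => f _; rewrite mean_sum.
rewrite mulr_suml mulr_sumr; apply: ler_sum => f _.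
rewrite mulr_suml mulr_sumr; apply: ler_sum => g _.
exact: hit2_prob.
Qed.

Definition trop_prob : F := mean (fun G col => (has_trop_dom G col)%:R).

(* [1 - (1 - t x)^2] is at most [1], and vanishes at [x = 0]. *)
Lemma trop_prob_second_moment (m Q : F) : 0 <= m -> m <= mean hits ->
  mean (fun G col => hits G col ^+ 2) <= Q -> 0 < Q -> m ^+ 2 / Q <= trop_prob.
Proof.
(* This [t] maximises [2 t m - t ^ 2 Q], with maximum [m ^ 2 / Q]. *)
move=> m0 mX XQ Q0; pose t := m / Q.
have t0 : 0 <= t by rewrite divr_ge0 // ltW.
have : mean (fun G col => 2 * t * hits G col - t ^+ 2 * hits G col ^+ 2) <= trop_prob.
  apply: mean_le => G col.
  case: (boolP (has_trop_dom G col)) => h /=.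
    by have := sqr_ge0 (1 - t * hits G col); rewrite mulr1n; lra.
  rewrite /hits big1 ?mulr0 ?expr0n ?mulr0 ?subrr // => f _.
  by case: (boolP (hit f G col)) => // /hit_trop_dom; rewrite (negPf h).
rewrite meanB; apply: le_trans.
have tm : m ^+ 2 / Q = t * m by rewrite /t expr2; field; rewrite gt_eqF.
have tQ : t ^+ 2 * Q = t * m by rewrite /t; field; rewrite gt_eqF.
have := ler_wpM2l (sqr_ge0 t) XQ; have := ler_wpM2l t0 mX; rewrite tQ tm; lra.
Qed.

Lemma ffact_ge : (c <= n)%N -> ((n - c) ^ c <= n ^_ c)%N.
Proof.
move=> cn; rewrite ffact_prod -[X in (_ ^ X <= _)%N](card_ord c) -prod_nat_const.
by apply: leq_prod => i _; rewrite leq_sub2l // ltnW.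
Qed.

Lemma bernoulli (x : F) k : 0 <= x <= 1 -> 1 - k%:R * (1 - x) <= x ^+ k.
Proof.
case/andP=> x0 x1; elim: k => [|k IH]; first by rewrite mul0r subr0.
have := ler_wpM2l x0 IH; rewrite -exprS; apply: le_trans.
have : 0 <= k%:R * (1 - x) ^+ 2 by rewrite mulr_ge0 ?sqr_ge0.
by rewrite -natr1; lra.
Qed.

Lemma trop_prob_le1 : trop_prob <= 1.
Proof. by rewrite -mean1; apply: mean_le => G col; case: has_trop_dom. Qed.

(** The second moment ratio [m ^+ 2 / Q] collapses to [r ^+ c]. Bernoulli's inequality linearises
    this power, and [r] falls short of 1 by at most [4 a + 2 u + w]. *)
Lemma trop_prob_ge : (c <= n)%N -> a < 1 ->
  1 - c%:R * (4 * a + 2 * (c%:R / n%:R) + c%:R * y / n%:R) <= trop_prob.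
Proof.
move=> cn a1.
have n0 : 0 < n%:R :> F by rewrite ltr0n (leq_trans c0).
have c1 : 0 < c%:R :> F by rewrite ltr0n.
have a2 : 0 < 1 - a by rewrite subr_gt0.
have a0 : 0 <= a by rewrite exprn_ge0.
set u := c%:R / n%:R; set w := c%:R * y / n%:R.
have u0 : 0 <= u by rewrite divr_ge0 ?ltW.
have u1 : u <= 1 by rewrite ler_pdivrMr // mul1r ler_nat.
have w0 : 0 <= w by rewrite divr_ge0 ?mulr_ge0 // ltW.
(* Since [n (1 - u) = n - c], this replaces the falling factorial by [(n - c) ^ c]. *)
pose m := n%:R ^+ c * (1 - u) ^+ c * (c%:R^-1 ^+ c * (1 - a) ^+ n).
pose Q := c%:R^-1 ^+ (2 * c) * (1 - a) ^+ (2 * n) *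
  (n%:R * (n%:R * (1 + w))) ^+ c / (1 - a) ^+ (4 * c).
pose r := (1 - u) ^+ 2 * (1 - a) ^+ 4 / (1 + w).
have w1 : 0 < 1 + w by rewrite ltr_wpDr ?ltr01.
have mQ : m ^+ 2 / Q = r ^+ c.
  rewrite /m /Q /r (mulnC 2%N c) (mulnC 2%N n) !(exprM _ _ 2) (exprM _ 4 c).
  have rc (X Y Z : F) : (X * Y / Z) ^+ c = X ^+ c * Y ^+ c / Z ^+ c.
    by rewrite !exprMn exprVn.
  rewrite rc (exprAC _ 2 c) !(exprMn c n%:R) exprVn.
  have [h1 h2 h3] : [/\ n%:R ^+ c != 0 :> F, c%:R ^+ c != 0 :> F & (1 - a) ^+ n != 0].
    by rewrite !expf_neq0 // gt_eqF.
  have [h4 h5] : ((1 - a) ^+ 4) ^+ c != 0 /\ (1 + w) ^+ c != 0.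
    by rewrite !expf_neq0 // gt_eqF.
  move: (n%:R ^+ c) (c%:R ^+ c) ((1 - a) ^+ n) (((1 - a) ^+ 4) ^+ c) ((1 + w) ^+ c)
    h1 h2 h3 h4 h5 => x1 x2 x3 x4 x5 h1 h2 h3 h4 h5.
  by field; rewrite h1 h2 h3 h4 h5.
have Q0 : 0 < Q by rewrite !(mulr_gt0, exprn_gt0, invr_gt0).
have le1 : m ^+ 2 / Q <= trop_prob.
  apply: trop_prob_second_moment => //.
  - by rewrite !mulr_ge0 ?exprn_ge0 ?invr_ge0 ?subr_ge0 // ltW.
  - apply: le_trans mean_hits; rewrite /m.
    rewrite ler_wpM2r ?mulr_ge0 ?exprn_ge0 ?invr_ge0 ?(ltW a2) //.
    rewrite -exprMn (_ : n%:R * (1 - u) = (n - c)%:R).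
      by rewrite -natrX ler_nat ffact_ge.
    by rewrite natrB // /u; field; rewrite gt_eqF.
  - rewrite /Q ler_pdivlMr ?exprn_gt0 //; apply: le_trans mean_hits2 _.
    rewrite ler_wpM2l ?mulr_ge0 ?exprn_ge0 ?invr_ge0 ?(ltW a2) //.
    have E : n%:R * (1 + w) = n%:R + c%:R * y by rewrite /w; field; rewrite gt_eqF.
    have n1 : 1 <= n%:R :> F by rewrite ler1n (leq_trans c0).
    have cy : 0 <= c%:R * y by rewrite mulr_ge0 // ltW.
    have n2 : 0 <= n%:R - 1 + c%:R * y by rewrite addr_ge0 ?subr_ge0.
    by rewrite E lerXn2r ?nnegrE ?mulr_ge0 // ?ler_wpM2l //; lra.
apply: le_trans le1; rewrite mQ.
have x1 : 1 - 2 * u <= (1 - u) ^+ 2 by have := sqr_ge0 u; lra.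
have x1' : (1 - u) ^+ 2 <= 1 by rewrite exprn_ile1 // ?subr_ge0 //; lra.
have z1 : 1 - 4 * a <= (1 - a) ^+ 4.
  by have := @bernoulli (1 - a) 4; rewrite opprB addrCA subrr addr0; apply; lra.
have z1' : (1 - a) ^+ 4 <= 1 by rewrite exprn_ile1 //; lra.
have v1 : 1 - w <= (1 + w)^-1.
  by rewrite -[leRHS]mul1r ler_pdivlMr //; have := sqr_ge0 w; lra.
have v1' : (1 + w)^-1 <= 1 by rewrite invf_le1 //; lra.
have r01 : 0 <= r <= 1.
  have [h1 h2 h3] : [/\ 0 <= (1 - u) ^+ 2, 0 <= (1 - a) ^+ 4 & 0 <= (1 + w)^-1].
    by rewrite sqr_ge0 exprn_even_ge0 // invr_ge0 ltW.
  have h4 := mulr_ge0 h1 h2; rewrite /r (mulr_ge0 h4 h3) /=.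
  by apply: mulr_ile1 => //; apply: mulr_ile1.
apply: le_trans (bernoulli c r01); rewrite lerB // ler_wpM2l //.
rewrite /r; set X := (1 - u) ^+ 2 in x1 x1' *; set Y := (1 - a) ^+ 4 in z1 z1' *.
set Z := (1 + w)^-1 in v1 v1' *.
have Z0 : 0 <= Z by rewrite invr_ge0 ltW.
(* This product and the next add up to [1 - X Y Z <= (1 - X) + (1 - Y) + (1 - Z)]. *)
have : 0 <= (1 - X) * (1 - Y) * Z by rewrite !mulr_ge0 ?subr_ge0.
have : 0 <= (1 - X + (1 - Y)) * (1 - Z) by apply: mulr_ge0; lra.
lra.
Qed.
End SecondMoment.
End Moments.

(* Transfer to the real numbers and the convexity bound for pairs *)
From mathcomp Require Import Rstruct.
From Stdlib Require Import Reals Lra ZArith.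

Section RealBound.
Local Open Scope R_scope.

Lemma trop_dom_probE (p : R) (n c : nat) :
  trop_dom_prob p n c = trop_prob n p (1 - p) c.
Proof.
apply: eq_bigr => G _; rewrite big_mkcond; apply: eq_bigr => col _.
rewrite /weight /edge_weight !RpowE INRE RinvE.
case: has_trop_dom; by rewrite ?GRing.mulr1 ?GRing.mulr0.
Qed.

Lemma trop_dom_prob_bounds (p y : R) (n c : nat) :
  0 < p < 1 -> (0 < c)%nat -> (c <= n)%nat -> 0 <= y ->
  (forall k, (k <= c)%nat ->
    (1 - (1 - p) ^ c - (1 - p) ^ c + (1 - p) ^ (c + c - k)) ^ n
    <= (1 - (1 - p) ^ c) ^ (2 * n) * y ^ k) ->
  1 - INR c * (4 * (1 - p) ^ c + 2 * (INR c / INR n) + INR c * y / INR n)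
   <= trop_dom_prob p n c <= 1.
Proof.
move=> [p0 p1] c0 cn y0 hy; rewrite trop_dom_probE.
have hp : Order.le 0 p by apply/RleP; lra.
have hq : Order.le 0 (1 - p) by apply/RleP; lra.
have pq : GRing.add p (1 - p) = 1 by change (p + (1 - p) = 1); lra.
split; apply/RleP; last exact: trop_prob_le1.
have e4 : GRing.natmul 1 4 = 4 :> R by rewrite -INRE /=; lra.
have e2 : GRing.natmul 1 2 = 2 :> R by rewrite -INRE /=; lra.
have := @trop_prob_ge R n p (1 - p) hp hq pq c c0 y.
rewrite e4 e2 -!RpowE -!INRE; apply.
- by apply/RleP.
- move=> k kc; have := hy k kc; rewrite !RpowE => h; exact/RleP.
- by [].
- by apply/RltP; apply: (pow_lt_1_compat (1 - p) c _ _).2; [lra | apply/ltP].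
Qed.

Lemma pow_01 (q : R) (j : nat) : 0 <= q <= 1 -> 0 <= q ^ j <= 1.
Proof.
move=> hq; split; first by apply: pow_le; lra.
by rewrite -(pow1 j); apply: pow_incr.
Qed.

(** The drop is a sum of [m] steps [(1 - q) * q ^ i] with [i >= j], each at most the first. *)
Lemma pow_sub_le (q : R) (j m : nat) : 0 <= q <= 1 ->
  q ^ j - q ^ (j + m) <= INR m * ((1 - q) * q ^ j).
Proof.
move=> hq; elim: m => [|m IH]; first by rewrite addn0 /=; lra.
rewrite addnS S_INR /=.
have h : q ^ (j + m) <= q ^ j.
  by rewrite pow_add; have := pow_01 j hq; have := pow_01 m hq; nra.
nra.
Qed.

Lemma pow_sub1_ge (q : R) (j : nat) : 0 <= q <= 1 ->
  INR j * ((1 - q) * q ^ j) <= 1 - q ^ j.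
Proof.
move=> hq; elim: j => [|j IH]; first by rewrite /=; lra.
rewrite S_INR /=; have := pow_01 j hq; have := pos_INR j.
move: (q ^ j) (INR j) IH => x J h1 h2 h3.
have h4 := Rmult_le_compat_l _ _ _ hq.1 h1.
have h5 : 0 <= (1 - q) * (1 - q * x) by apply: Rmult_le_pos; nra.
lra.
Qed.

(* [x |-> q ^ x] lies below its chord over [0, c]. *)
Lemma pow_chord (q : R) (c j : nat) : 0 <= q <= 1 -> (j <= c)%nat ->
  INR c * (q ^ j - q ^ c) <= INR (c - j).
Proof.
move=> hq jc; have := @pow_sub_le q j (c - j) hq; have := @pow_sub1_ge q j hq.
have -> : INR c = INR j + INR (c - j).
  by rewrite -plus_INR; apply: (f_equal INR (esym (subnKC jc))).
rewrite subnKC //.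
have := pow_01 c hq; have := pos_INR j; have := pos_INR (c - j).
move: (INR j) (INR (c - j)) ((1 - q) * q ^ j) (q ^ j) (q ^ c) => J M d x z.
move=> M0 J0 z01 h1 h2.
(* Compare slopes at [j]: [J (x - z) <= J M d <= M (1 - x)]; then add [M (x - z)] and use
   [z >= 0]. *)
have := Rmult_le_compat_l _ _ _ J0 h2; have := Rmult_le_compat_l _ _ _ M0 h1.
nra.
Qed.

Lemma exp_mul_nat (x : R) (k : nat) : exp x ^ k = exp (INR k * x).
Proof.
elim: k => [|k IH]; first by rewrite Rmult_0_l exp_0.
by rewrite S_INR /= IH -exp_plus; congr exp; ring.
Qed.

(** This supplies the pair hypothesis of the second moment bound. The chord bound gives
    [x - a <= k / c], so the base is at most [(1 - a) ^ 2 * (1 + k th)], and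
    [1 + k th <= exp (k th)]. *)
Lemma pair_dom_le (p : R) (n c k : nat) :
  0 < p < 1 -> (0 < c)%nat -> (k <= c)%nat ->
  (1 - (1 - p) ^ c - (1 - p) ^ c + (1 - p) ^ (c + c - k)) ^ n
  <= (1 - (1 - p) ^ c) ^ (2 * n) *
     exp (INR n * ((1 - p) ^ c / (INR c * (1 - (1 - p) ^ c) ^ 2))) ^ k.
Proof.
move=> hp c0 kc; set q := 1 - p.
have hq : 0 <= q <= 1 by rewrite /q; lra.
have C0 : 0 < INR c by apply: lt_0_INR; apply/ltP.
have a1 : 0 <= q ^ c < 1 by apply: pow_lt_1_compat; [rewrite /q; lra | apply/ltP].
have := @pow_chord q c (c - k) hq (leq_subr _ _); rewrite subKn // => ch.
have -> : (c + c - k)%nat = (c + (c - k))%nat by rewrite addnBA.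
rewrite pow_add; set x := q ^ (c - k) in ch *.
have x0 : 0 <= x by apply: pow_le; lra.
set a := q ^ c in a1 ch *; set th := a / _.
have d0 : 0 < (1 - a) ^ 2 by apply: pow_lt; lra.
have le1 : 1 - a - a + a * x <= (1 - a) ^ 2 * exp (INR k * th).
  have e1 := exp_ineq1_le (INR k * th).
  have e2 : (1 - a) ^ 2 * (1 + INR k * th) = (1 - a) ^ 2 + a * (INR k / INR c).
    by rewrite /th; field; lra.
  have e3 : x - a <= INR k / INR c.
    apply: (Rmult_le_reg_l (INR c)) => //.
    have -> : INR c * (INR k / INR c) = INR k by field; lra.
    exact: ch.
  have := Rmult_le_compat_l _ _ _ (Rlt_le _ _ d0) e1; rewrite e2.
  have := Rmult_le_compat_l _ _ _ a1.1 e3.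
  nra.
have B0 : 0 <= 1 - a - a + a * x.
  have : a <= x.
    apply: Rle_trans (_ : q ^ (c - k + k) <= _); first by rewrite subnK // -/a; lra.
    by rewrite pow_add -/x; have := pow_01 k hq; nra.
  nra.
apply: Rle_trans (pow_incr _ _ n (conj B0 le1)) _.
rewrite Rpow_mult_distr -pow_mult !exp_mul_nat; apply: Req_le; congr (_ * exp _); ring.
Qed.
End RealBound.

(** * Growth estimates for the given number of colours *)

Section Asymptotics.
Local Open Scope R_scope.

Lemma exp_ge_pow (k : nat) (x : R) : (0 < k)%nat -> 0 <= x ->
  (x / INR k) ^ k <= exp x.
Proof.
move=> k0 x0; have K0 : 0 < INR k by apply: lt_0_INR; apply/ltP.
have {2}-> : x = INR k * (x / INR k) by field; lra.
rewrite -exp_mul_nat; apply: pow_incr.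
have y0 : 0 <= x / INR k by apply: Rle_mult_inv_pos.
by have := exp_ineq1_le (x / INR k); lra.
Qed.

Lemma exp_le_compat (x y : R) : x <= y -> exp x <= exp y.
Proof. by case=> [h|->]; [left; apply: exp_increasing | right]. Qed.

Lemma ln_le_compat (x y : R) : 0 < x -> x <= y -> ln x <= ln y.
Proof. by move=> x0 [h|->]; [left; apply: ln_increasing | right]. Qed.

(** [Z.to_nat] sends negative integers to 0; positivity of [M + 1] excludes them, so the floor
    bounds carry over. *)
Lemma cfun_bounds (p : R) (n : nat) :
  let M := logb p (INR n) - logb p (logb p (INR n) * ln (INR n)) in
  0 < M + 1 -> M + 1 < INR (cfun p n) <= M + 2.
Proof.
move=> M M1; have [h1 h2] := base_Int_part M.
have c0 : (0 <= Int_part M + 2)%Z.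
  by apply: le_IZR; rewrite plus_IZR; lra.
by rewrite /cfun -/M INR_IZR_INZ Z2Nat.id // plus_IZR; lra.
Qed.

Lemma ln_inv_compl_gt0 (p : R) : 0 < p < 1 -> 0 < ln (1 / (1 - p)).
Proof.
move=> hp; rewrite -ln_1; apply: ln_increasing; first lra.
apply: (Rmult_lt_reg_l (1 - p)); first lra.
by have -> : (1 - p) * (1 / (1 - p)) = 1 by [field; lra]; lra.
Qed.

Lemma pow_compl_exp (p : R) (c : nat) : 0 < p < 1 ->
  (1 - p) ^ c = exp (- (ln (1 / (1 - p)) * INR c)).
Proof.
move=> hp; have -> : 1 - p = exp (- ln (1 / (1 - p))).
  rewrite exp_Ropp exp_ln; first by field; lra.
  by apply: Rdiv_lt_0_compat; lra.
rewrite exp_mul_nat.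
have -> : 1 / exp (- ln (1 / (1 - p))) = 1 / (1 - p).
  by rewrite exp_Ropp exp_ln; [field; lra | apply: Rdiv_lt_0_compat; lra].
by congr exp; ring.
Qed.

(* With [t = ln n], the number of colours is [(1 + o(1)) t / lam], so the
   parameter [y] of the pair bound is at most [n ^ (1 - p / 2)]. *)
Lemma trop_dom_prob_lower (p : R) (n : nat) (hp : 0 < p < 1)
    (lam := ln (1 / (1 - p))) (t := ln (INR n)) :
  (0 < n)%nat -> 1 <= t -> 2 * lam <= t -> 8 / lam <= t ->
  (12 / p) ^ 3 / lam <= t -> lam <= t -> 16 / p <= t ->
  1 - 20 / lam ^ 2 * (8 / p) ^ 4 / t <= trop_dom_prob p n (cfun p n) <= 1.
Proof.
move=> n0 t1 t2 t3 t4 t5 t6.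
have lam0 : 0 < lam by apply: ln_inv_compl_gt0.
have N0 : 0 < INR n by apply: lt_0_INR; apply/ltP.
have Nt : INR n = exp t by rewrite exp_ln.
set c := cfun p n; set C := INR c; set a := (1 - p) ^ c.
(* [L] is [log_b n], and [M] is the real number whose floor enters [cfun]. *)
pose L := t / lam; pose l2 := ln (L * t); pose M := L - l2 / lam.
have tL : t = lam * L by rewrite /L; field; lra.
have L2 : 2 <= L by rewrite tL in t2; nra.
have Lt1 : 1 <= L * t by nra.
(* The cubic [(p t / 12) ^ 3] overtakes the quadratic [L t] at [t = (12 / p) ^ 3 / lam]. *)
have Ltexp : L * t <= exp (p * t / 4).
  have h0 : 0 <= p * t / 4 by nra.
  apply: Rle_trans (@exp_ge_pow 3 (p * t / 4) isT h0).
  have -> : (p * t / 4 / INR 3) ^ 3 = (p / 12) ^ 3 * t ^ 2 * t.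
    by rewrite /=; field; lra.
  have -> : L * t = (p / 12) ^ 3 * t ^ 2 * ((12 / p) ^ 3 / lam).
    by rewrite /L; field; lra.
  apply: Rmult_le_compat_l => //; apply: Rmult_le_pos; apply: pow_le; lra.
have l2pos : 0 <= l2 by rewrite -ln_1; apply: ln_le_compat; lra.
have l2le : l2 <= p * t / 4.
  by rewrite -(ln_exp (p * t / 4)); apply: ln_le_compat => //; lra.
have M0 : (1 - p / 4) * L <= M.
  apply: (Rmult_le_reg_l lam) => //.
  have -> : lam * M = t - l2 by rewrite /M /L; field; lra.
  by rewrite -Rmult_assoc (Rmult_comm lam) Rmult_assoc -tL; lra.
have [b1 b2] : M + 1 < C <= M + 2 by apply: cfun_bounds; rewrite -/M; nra.
have C2 : C <= 2 * L.
  have : 0 <= l2 / lam by apply: Rle_mult_inv_pos.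
  by rewrite /M in b2; lra.
have C1 : (1 - p / 4) * L <= C by lra.
have C0 : 0 < C by nra.
have c0 : (0 < c)%nat by apply/ltP; apply: INR_lt.
(* Chain [c <= 2 L <= t ^ 2 / 4 <= exp t = n], using [8 / lam <= t]. *)
have cn : (c <= n)%nat.
  apply/leP; apply: INR_le; rewrite -/C Nt.
  have h0 : 0 <= t by lra.
  apply: Rle_trans (@exp_ge_pow 2 t isT h0); apply: Rle_trans C2 _.
  have -> : 2 * L = t / 4 * (8 / lam) by rewrite /L; field; lra.
  have -> : (t / INR 2) ^ 2 = t / 4 * t by rewrite /=; field.
  by apply: Rmult_le_compat_l => //; lra.
(* The 1 in [M + 1 < C] yields the factor [1 - p], which keeps the exponent of [n] in [y] below
   1. *)
have a_le : a <= (1 - p) * (L * t) * exp (- t).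
  rewrite /a pow_compl_exp // -/lam -/C.
  have -> : (1 - p) * (L * t) * exp (- t) = exp (- (lam * (M + 1))).
    have -> : - (lam * (M + 1)) = - lam + l2 + - t by rewrite /M /L; field; lra.
    rewrite !exp_plus /l2 exp_ln; last lra.
    by have := @pow_compl_exp p 1 hp; rewrite -/lam /= !Rmult_1_r => ->.
  by apply: exp_le_compat; nra.
have Et : exp (- t) * INR n = 1 by rewrite Nt -exp_plus Rplus_opp_l exp_0.
have E0 := exp_pos (- t).
have a0 : 0 < a by apply: pow_lt; lra.
(* This makes [(1 - a) ^ 2] at least [1 - p / 4]. *)
have a8 : a <= p / 8.
  have h1 : a <= exp (- (t / 2)).
    apply: Rle_trans a_le _.
    have h2 : (1 - p) * (L * t) <= exp (t / 2).
      apply: Rle_trans (_ : exp (p * t / 4) <= _); first by nra.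
      by apply: exp_le_compat; nra.
    have -> : exp (- (t / 2)) = exp (t / 2) * exp (- t).
      by rewrite -exp_plus; congr exp; field.
    by apply: Rmult_le_compat_r; lra.
  have h2 := exp_ineq1_le (t / 2).
  have h3 : exp (- (t / 2)) * exp (t / 2) = 1 by rewrite -exp_plus Rplus_opp_l exp_0.
  have h4 := exp_pos (- (t / 2)).
  have h5 : 8 / p <= exp (t / 2) by lra.
  apply: Rle_trans h1 _; apply: (Rmult_le_reg_r (8 / p)).
    by apply: Rdiv_lt_0_compat; lra.
  have -> : p / 8 * (8 / p) = 1 by field; lra.
  by rewrite -h3; apply: Rmult_le_compat_l; lra.
set y := exp (INR n * (a / (C * (1 - a) ^ 2))).
have y_le : y <= exp ((1 - p / 2) * t).
  apply: exp_le_compat.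
  have d0 : 0 < C * (1 - a) ^ 2 by apply: Rmult_lt_0_compat => //; apply: pow_lt; lra.
  apply: (Rmult_le_reg_r (C * (1 - a) ^ 2)) => //.
  have -> : INR n * (a / (C * (1 - a) ^ 2)) * (C * (1 - a) ^ 2) = INR n * a.
    by field; split; lra.
  have na : INR n * a <= (1 - p) * (L * t).
    have h := Rmult_le_compat_l _ _ _ (Rlt_le _ _ N0) a_le.
    apply: Rle_trans h _; apply: Req_le.
    by rewrite -[RHS]Rmult_1_r -Et; ring.
  apply: Rle_trans na _.
  have d1 : (1 - p / 4) * L * (1 - p / 4) <= C * (1 - a) ^ 2.
    apply: Rmult_le_compat => //; nra.
  have h1 : 0 <= (1 - p / 2) * t by nra.
  have h2 := Rmult_le_compat_l _ _ _ h1 d1.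
  apply: Rle_trans h2.
  (* One factor [1 - p / 4] comes from [C1], the other from [(1 - a) ^ 2]. *)
  have h3 : 1 - p <= (1 - p / 2) * ((1 - p / 4) * (1 - p / 4)) by nra.
  have h4 : 0 <= L * t by lra.
  have := Rmult_le_compat_r _ _ _ h4 h3; lra.
(* [E] is [n ^ (- p / 2)], the common scale of all error terms. *)
pose E := exp (- (p * t / 2)).
have EE : 0 < E := exp_pos _.
have nE : / INR n <= E.
  rewrite Nt -exp_Ropp; apply: exp_le_compat; nra.
have yE : y / INR n <= E.
  have -> : E = exp ((1 - p / 2) * t) / INR n.
    by rewrite Nt /Rdiv -exp_Ropp -exp_plus; congr exp; field.
  by apply: Rmult_le_compat_r => //; apply: Rlt_le; apply: Rinv_0_lt_compat.
have aE : a <= L * t * E.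
  apply: Rle_trans a_le _; apply: Rmult_le_compat; try nra.
  by apply: exp_le_compat; nra.
(* The total error has order [L ^ 2 t E], cubic in [t] up to [E]; a fourth power leaves [1 / t]. *)
have E4 : E * (p * t / 8) ^ 4 <= 1.
  have h0 : 0 <= p * t / 2 by nra.
  have := @exp_ge_pow 4 (p * t / 2) isT h0.
  have -> : p * t / 2 / INR 4 = p * t / 8 by rewrite /=; field.
  move/(Rmult_le_compat_l E); have -> : E * exp (p * t / 2) = 1.
    by rewrite -exp_plus Rplus_opp_l exp_0.
  by apply; lra.
have y0 : 0 <= y by left; apply: exp_pos.
have [lo hi] := trop_dom_prob_bounds hp c0 cn y0
  (fun k kc => @pair_dom_le p n c k hp c0 kc).
split => //; apply: Rle_trans lo; rewrite -/a -/C.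
apply: Rplus_le_compat_l; apply: Ropp_le_contravar.
have e1 : 4 * a + 2 * (C / INR n) + C * y / INR n <= (4 * t + 6) * L * E.
  have : C / INR n <= 2 * L * E.
    by apply: Rmult_le_compat => //; [lra | apply: Rlt_le; apply: Rinv_0_lt_compat].
  have : C * y / INR n <= 2 * L * E.
    rewrite /Rdiv Rmult_assoc; apply: Rmult_le_compat => //; first lra.
    by apply: Rle_mult_inv_pos.
  lra.
have e2 : C * (4 * a + 2 * (C / INR n) + C * y / INR n) <= 2 * L * ((10 * t) * L * E).
  apply: Rmult_le_compat => //; first lra.
    have h1 : 0 <= C / INR n by apply: Rle_mult_inv_pos; lra.
    have h2 : 0 <= C * y / INR n by apply: Rle_mult_inv_pos => //; nra.
    lra.
  apply: Rle_trans e1 _; apply: Rmult_le_compat_r; first lra.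
  by apply: Rmult_le_compat_r; lra.
apply: Rle_trans e2 _.
have -> : 2 * L * (10 * t * L * E) =
   20 / lam ^ 2 * (8 / p) ^ 4 / t * (E * (p * t / 8) ^ 4).
  by rewrite /L; field; lra.
rewrite -[X in _ <= X]Rmult_1_r; apply: Rmult_le_compat_l => //.
apply: Rle_mult_inv_pos; last lra.
apply: Rmult_le_pos; last by apply: pow_le; apply: Rle_mult_inv_pos; lra.
by apply: Rle_mult_inv_pos; [lra | apply: pow_lt].
Qed.
End Asymptotics.

(** * Passage to the limit in [n] *)

Theorem mainTheorem10 (p : R) (hp : (0 < p < 1)%R) :
  Un_cv (fun n : nat => trop_dom_prob p n (cfun p n)) 1%R.
Proof.
move=> eps eps0; set lam := ln (1 / (1 - p))%R.
pose K := (20 / lam ^ 2 * (8 / p) ^ 4)%R.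
(* Absolute values make the sum dominate every threshold for [ln n], and [K / eps] as well. *)
pose T := (1 + Rabs (2 * lam) + Rabs (8 / lam) + Rabs ((12 / p) ^ 3 / lam)
  + Rabs lam + Rabs (16 / p) + Rabs (K / eps))%R.
have [N hN] := INR_unbounded (exp T).
exists N => n nN.
have Nn : (exp T < INR n)%R by apply: Rlt_le_trans hN _; apply: le_INR.
have n0 : (0 < n)%nat.
  by apply/ltP; apply: INR_lt; apply: Rlt_trans Nn; apply: exp_pos.
have Tt : (T < ln (INR n))%R.
  by rewrite -(ln_exp T); apply: ln_increasing => //; apply: exp_pos.
have := (Rle_abs (2 * lam), Rle_abs (8 / lam), Rle_abs ((12 / p) ^ 3 / lam),
  Rle_abs lam, Rle_abs (16 / p), Rle_abs (K / eps))%R.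
move=> [[[[[h1 h2] h3] h4] h5] h6].
have := (Rabs_pos (2 * lam), Rabs_pos (8 / lam), Rabs_pos ((12 / p) ^ 3 / lam),
  Rabs_pos lam, Rabs_pos (16 / p), Rabs_pos (K / eps))%R.
move=> [[[[[g1 g2] g3] g4] g5] g6].
rewrite /T in Tt.
have [|||||||lo hi] := @trop_dom_prob_lower p n hp; rewrite -/lam => //; try lra.
rewrite -/lam -/K in lo.
have Kt : (K / ln (INR n) < eps)%R.
  apply: (Rmult_lt_reg_r (ln (INR n))); first lra.
  have -> : (K / ln (INR n) * ln (INR n) = K)%R by field; lra.
  have -> : (K = eps * (K / eps))%R by field; lra.
  by apply: Rmult_lt_compat_l; lra.
rewrite /R_dist Rabs_left1; lra.
Qed.
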